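(* For every $n\ge 2$, the projectors $f_n\in VTL_n(d)$ and $f_{n-1}\in VTL_{n-1}(d)\subset VTL_n(d)$ satisfy $$f_n=f_{n-1}f_n^{\mathcal{K}},$$ where $f_n^{\mathcal{K}}\in VTL_n(d)$ is defined recursively by $$f_2^{\mathcal{K}}=x_1 1_2+y_1e_1+z_1v_1,\qquad f_n^{\mathcal{K}}=x_{n-1}1_n+y_{n-1}e_{n-1}f_{n-1}^{\mathcal{K}}+z_{n-1}v_{n-1}f_{n-1}^{\mathcal{K}}\quad(n\ge 3),$$ with $x_i=\frac{1}{i+1}$, $y_i=-\frac{2i}{(i+1)(d+2i-2)}$, $z_i=\frac{i}{i+1}$.
   Context: Let $d$ be an indeterminate and $K=\mathbb{C}(d)$. The virtual Temperley-Lieb algebra $VTL_n(d)$ is the unital associative $K$-algebra (isomorphic to the Brauer algebra with parameter $d$) with $K$-basis the set of all $(2n-1)!!$ diagrams (''connection elements''), i.e. perfect matchings of $2n$ points consisting of $n$ top points $1,\dots,n$ and $n$ bottom points $1,\dots,n$. The product $XY$ of diagrams is obtained by stacking $X$ above $Y$, identifying the bottom points of $X$ with the top points of $Y$, replacing each closed loop formed by a factor $d$. The identity $1_n$ joins top $j$ to bottom $j$ for all $j$. For $1\le i\le n-1$: $e_i$ joins top $i$ to top $i+1$, bottom $i$ to bottom $i+1$, and top $j$ to bottom $j$ for $j\ne i,i+1$; $v_i$ joins top $i$ to bottom $i+1$, top $i+1$ to bottom $i$, and top $j$ to bottom $j$ for $j\ne i,i+1$. $VTL_{n-1}(d)$ is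 regarded as a subalgebra of $VTL_n(d)$ by adding a vertical strand joining top $n$ to bottom $n$. For each $n\ge1$, the projector $f_n\in VTL_n(d)$ is the unique non-zero element with $f_n^2=f_n$, $f_ne_i=e_if_n=0$ and $f_nv_i=v_if_n=f_n$ for all $1\le i\le n-1$. Equivalently, $f_1=1_1$ and, for $n\ge2$, $f_n=x_{n-1}f_{n-1}+y_{n-1}f_{n-1}e_{n-1}f_{n-1}+z_{n-1}f_{n-1}v_{n-1}f_{n-1}$, where $x_i=\frac{1}{i+1}$, $y_i=-\frac{2i}{(i+1)(d+2i-2)}$ and $z_i=\frac{i}{i+1}$. *)

(* Defs.v *)
From HB Require Import structures.
From mathcomp Require Import all_boot all_order all_fingroup all_algebra.
From mathcomp Require Export complex reals.
Set Implicit Arguments.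
Unset Strict Implicit.
Unset Printing Implicit Defensive.
Import GRing.Theory.
Local Open Scope ring_scope.

(* inl i is the i-th top point, inr i the i-th bottom point, counted from 0. *)
Definition point (n : nat) : finType := ('I_n + 'I_n)%type.

Section Diagrams.
Variable n : nat.

(* A perfect matching is encoded as the fixed-point-free involution sending
   each point to its partner. *)
Definition is_matching (s : {ffun point n -> point n}) : bool :=
  [forall p, (s p != p) && (s (s p) == p)].

Record diagram := Diagram {
  partner :> {ffun point n -> point n};
  partnerP : is_matching partner }.

HB.instance Definition _ := [isSub for partner].
HB.instance Definition _ := [Finite of diagram by <:].

Lemma is_matchingP (s : {ffun point n -> point n}) :
  reflect (forall p, s p != p /\ s (s p) = p) (is_matching s).
Proof.
apply: (iffP forallP) => sP p.
  by case/andP: (sP p) => ? /eqP.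
by case: (sP p) => -> ->; rewrite eqxx.
Qed.

Lemma partner_neq (X : diagram) p : X p != p.
Proof. by case: (is_matchingP _ (partnerP X) p). Qed.

Lemma partnerK (X : diagram) : involutive X.
Proof. by move=> p; case: (is_matchingP _ (partnerP X) p). Qed.

(* The 3n points of the picture of X stacked above Y: the top points of X, the
   middle points (bottom of X identified with top of Y), the bottom points
   of Y. *)
Definition stack_point : finType := ('I_n + 'I_n + 'I_n)%type.

Definition upper (p : point n) : stack_point := inl p.

Definition lower (p : point n) : stack_point :=
  match p with inl i => inl (inr i) | inr i => inr i end.

Definition outer (p : point n) : stack_point :=
  match p with inl i => inl (inl i) | inr i => inr i end.

Definition stack_edge (X Y : diagram) : rel stack_point := fun u w =>
  [exists p, (u == upper p) && (w == upper (X p))]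
  || [exists p, (u == lower p) && (w == lower (Y p))].

(* Z is the diagram underlying XY. *)
Definition is_stacking (X Y Z : diagram) : bool :=
  [forall p, forall q,
     (Z p == q) == (p != q) && connect (stack_edge X Y) (outer p) (outer q)].

(* The closed loops are the connected components that meet no outer point. *)
Definition loops (X Y : diagram) : nat :=
  n_comp (stack_edge X Y)
    [pred w | [forall p, ~~ connect (stack_edge X Y) w (outer p)]].

Definition id_fun : {ffun point n -> point n} :=
  [ffun p => match p with inl i => inr i | inr i => inl i end].

Lemma id_fun_matching : is_matching id_fun.
Proof. by apply/is_matchingP => -[] i; rewrite !ffunE. Qed.

Definition id_diag : diagram := Diagram id_fun_matching.

End Diagrams.

(* For i : 'I_n, these are the i-th and (i+1)-st of the n+1 positions. *)
Definition pos (n : nat) (i : 'I_n) : 'I_n.+1 := widen_ord (leqnSn n) i.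
Definition pos_succ (n : nat) (i : 'I_n) : 'I_n.+1 := lift ord0 i.

Section Generators.
Variables (n : nat) (i : 'I_n).

Let s := tperm (pos i) (pos_succ i).
Let touched := [pred j | (j == pos i) || (j == pos_succ i)].

Definition e_fun : {ffun point n.+1 -> point n.+1} :=
  [ffun p => match p with
             | inl j => if touched j then inl (s j) else inr j
             | inr j => if touched j then inr (s j) else inl j
             end].

Definition v_fun : {ffun point n.+1 -> point n.+1} :=
  [ffun p => match p with inl j => inr (s j) | inr j => inl (s j) end].

Let pos_neq : pos i != pos_succ i.
Proof. by rewrite -val_eqE /= /bump /= neq_ltn ltnSn. Qed.

Let touched_s j : touched (s j) = touched j.
Proof.
rewrite /= /s; case: tpermP => [->|->|//]; by rewrite !eqxx ?orbT.
Qed.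

Let s_neq j : touched j -> s j != j.
Proof.
by case/orP => /eqP ->; rewrite /s ?tpermL ?tpermR // eq_sym.
Qed.

Lemma e_fun_matching : is_matching e_fun.
Proof.
apply/is_matchingP => -[] j; rewrite !ffunE; case: ifP => tj; split=> //;
  rewrite ?touched_s ?tj ?tpermK //.
- by apply: contra (s_neq tj) => /eqP[->].
- by apply: contra (s_neq tj) => /eqP[->].
Qed.

Lemma v_fun_matching : is_matching v_fun.
Proof. by apply/is_matchingP => -[] j; rewrite !ffunE tpermK. Qed.

Definition e_diag : diagram n.+1 := Diagram e_fun_matching.
Definition v_diag : diagram n.+1 := Diagram v_fun_matching.

End Generators.

Section AddStrand.
Variables (n : nat) (X : diagram n).

Definition widen_point (p : point n) : point n.+1 :=
  match p with
  | inl i => inl (lift ord_max i)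
  | inr i => inr (lift ord_max i)
  end.

Definition add_strand_fun : {ffun point n.+1 -> point n.+1} :=
  [ffun p => match p with
             | inl j => if unlift ord_max j is Some i
                        then widen_point (X (inl i)) else inr ord_max
             | inr j => if unlift ord_max j is Some i
                        then widen_point (X (inr i)) else inl ord_max
             end].

Let widen_point_inj : injective widen_point.
Proof.
by case=> i [] j // [E]; congr (_ _); apply: (@lift_inj _ ord_max); apply: val_inj.
Qed.

Let add_strand_widen p : add_strand_fun (widen_point p) = widen_point (X p).
Proof. by case: p => i; rewrite ffunE /= liftK. Qed.

Lemma add_strand_matching : is_matching add_strand_fun.
Proof.
have old p : add_strand_fun (widen_point p) != widen_point p /\
    add_strand_fun (add_strand_fun (widen_point p)) = widen_point p.
  by rewrite !add_strand_widen (inj_eq widen_point_inj) partner_neq partnerK.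
have topE : add_strand_fun (inl ord_max) = inr ord_max.
  by rewrite ffunE unlift_none.
have botE : add_strand_fun (inr ord_max) = inl ord_max.
  by rewrite ffunE unlift_none.
apply/is_matchingP => -[] j; case: (unliftP ord_max j) => [i|] ->.
- exact: (old (inl i)).
- by rewrite ?(topE, botE).
- exact: (old (inr i)).
- by rewrite ?(topE, botE).
Qed.

Definition add_strand : diagram n.+1 := Diagram add_strand_matching.

End AddStrand.

(* The K-vector space with basis the diagrams, an element being its family of
   coefficients. The parameter d only enters the product mul_VTL; the pointwise
   product of coefficient functions is not used. *)
Definition VTL (K : fieldType) (d : K) (n : nat) := {ffun diagram n -> K^o}.
HB.instance Definition _ (K : fieldType) (d : K) (n : nat) :=
  GRing.Lmodule.on (VTL d n).

Section Algebra.
Variables (K : fieldType) (d : K).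

Definition basis_elt n (X : diagram n) : VTL d n :=
  [ffun Y : diagram n => (X == Y)%:R].

(* The bilinear extension of X * Y = d ^ (loops X Y) Z, where Z is the unique
   diagram such that is_stacking X Y Z. *)
Definition mul_VTL n (f g : VTL d n) : VTL d n :=
  \sum_(X : diagram n) \sum_(Y : diagram n) \sum_(Z | is_stacking X Y Z)
    (f X * g Y * d ^+ loops X Y) *: basis_elt Z.

Definition one_VTL n : VTL d n := basis_elt (id_diag n).

(* Generators are numbered from 0: gen_e i and gen_v i are $e_{i+1}$ and
   $v_{i+1}$ in $VTL_{n+1}(d)$, so ord_max gives the last ones, $e_n$, $v_n$. *)
Definition gen_e n (i : 'I_n) : VTL d n.+1 := basis_elt (e_diag i).
Definition gen_v n (i : 'I_n) : VTL d n.+1 := basis_elt (v_diag i).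

Definition incl_VTL n (f : VTL d n) : VTL d n.+1 :=
  \sum_(X : diagram n) f X *: basis_elt (add_strand X).

Definition x_coef (i : nat) : K := 1 / (i%:R + 1).
Definition y_coef (i : nat) : K :=
  - (2 * i%:R / ((i%:R + 1) * (d + 2 * i%:R - 2))).
Definition z_coef (i : nat) : K := i%:R / (i%:R + 1).

End Algebra.

Arguments one_VTL {K} d n.
Arguments gen_e {K} d {n} i.
Arguments gen_v {K} d {n} i.

Notation "f *v g" := (mul_VTL f g)
  (at level 40, left associativity) : ring_scope.

Definition is_projector (K : fieldType) (d : K) (n : nat) (f : VTL d n.+1) :=
  [/\ f != 0,
      f *v f = f,
      forall i : 'I_n, f *v gen_e d i = 0 /\ gen_e d i *v f = 0 &
      forall i : 'I_n, f *v gen_v d i = f /\ gen_v d i *v f = f].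

(* fK d m is $f_{m+2}^{\mathcal K}$. *)
Fixpoint fK (K : fieldType) (d : K) (m : nat) : VTL d m.+2 :=
  match m with
  | 0 => x_coef K 1 *: one_VTL d 2 + y_coef d 1 *: gen_e d ord_max
         + z_coef K 1 *: gen_v d ord_max
  | m'.+1 =>
      x_coef K m'.+2 *: one_VTL d m'.+3
      + y_coef d m'.+2 *: (gen_e d ord_max *v incl_VTL (fK d m'))
      + z_coef K m'.+2 *: (gen_v d ord_max *v incl_VTL (fK d m'))
  end.

(* $\mathbb C(d)$ and its indeterminate, with $\mathbb C$ = R[i]. *)
Notation ratfun R := {fraction {poly complex R}}.
Definition indet (R : realType) : ratfun R := tofrac ('X : {poly complex R}).

(* Main.v *)
From HB Require Import structures.
Require Import Defs.
From mathcomp Require Import all_boot all_order all_fingroup all_algebra.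
From mathcomp Require Import ring.
Set Implicit Arguments.
Unset Strict Implicit.
Unset Printing Implicit Defensive.
Import GRing.Theory.

(* The recursion P_n = x g + y g e g + z g v g, with g = P_(n-1), e = e_(n-1)
   and v = v_(n-1), produces an idempotent killed by all e_i and fixed by all
   v_i on the left; only e P_n = 0 and v P_n = P_n need work, and they follow by
   expanding one factor g once more by the recursion and applying the Brauer
   relations. Every left multiple u P_n is a scalar multiple of P_n, so that a
   projector f satisfies f = f P_n = k P_n, and f f = f gives k = 1. Finally
   P_(n-1) absorbs P_(n-2), which commutes with e and v, and this turns the
   recursion into P_n = P_(n-1) f_n^K.

   Associativity and the Brauer relations are checked on two-colourings of the
   strand ends: a diagram becomes the 0/1 matrix of the colourings constant on
   its strands, and the product of the matrices of X and Y is 2^l times the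
   matrix of XY, with l the number of closed loops. This matrix determines both
   l and the diagram. *)

(** * Stacking of diagrams *)

Section DihedralOrbits.
Variables (T : finType) (mu nu : T -> T).
Hypotheses (muK : involutive mu) (nuK : involutive nu).
Hypothesis mu_neq : forall u, mu u != u.

Let phi u := nu (mu u).

Let phi_inj : injective phi.
Proof. exact: inj_comp (inv_inj nuK) (inv_inj muK). Qed.

(** Conjugation by [nu] inverts [phi], as in a dihedral group; the orbit arguments below rest on
    this. *)
Lemma dihedral_flip u : phi (nu (phi u)) = nu u.
Proof. by rewrite /phi nuK muK. Qed.

Lemma dihedral_flip_iter j u : iter j phi (nu (iter j phi u)) = nu u.
Proof. by elim: j u => // j IHj u; rewrite iterSr /= dihedral_flip IHj. Qed.

Lemma dihedral_connect_nu p u :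
  nu p = p -> fconnect phi p u -> fconnect phi p (nu u).
Proof.
move=> nup pu; rewrite -(iter_findex pu); set j := findex _ _ _.
rewrite fconnect_sym //; have := fconnect_iter phi j (nu (iter j phi p)).
by rewrite dihedral_flip_iter nup.
Qed.

Lemma dihedral_connect_mu p u :
  nu p = p -> fconnect phi p u -> fconnect phi p (mu u).
Proof.
move=> nup pu; rewrite -[mu u]nuK; apply: dihedral_connect_nu => //.
exact: connect_trans pu (fconnect1 _ _).
Qed.

(* A reflection fixing p fixes exactly one other point of its orbit: the one
   half-way around, the orbit having even length as mu fixes nothing. *)
Lemma dihedral_fixed p : nu p = p ->
  exists2 q, [/\ q != p, nu q = q & fconnect phi p q] &
    forall q', q' != p -> nu q' = q' -> fconnect phi p q' -> q' = q.
Proof.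
move=> nup; pose k := fingraph.order phi p.
have iterk : iter k phi p = p by exact: iter_order.
have iter_inj j : injective (iter j phi).
  by elim: j => //= j IHj x y /phi_inj /IHj.
have evenk : k = (k./2 + k./2)%N.
  (* If the order were 2j+1, the flip identity would give nu(phi^(j+1) p) = phi^j p, so [mu] would
     fix phi^j p. *)
  rewrite addnn; have [oddk|/even_halfK -> //] := boolP (odd k).
  pose j := k./2; have defk : k = (j.+1 + j)%N.
    by rewrite -[k]odd_double_half oddk -addnn.
  have /eqP[] := mu_neq (iter j phi p).
  have := dihedral_flip_iter j.+1 p; rewrite nup -{2}iterk defk iterD.
  by move/iter_inj; rewrite /= /phi nuK.
have k_gt0 : (0 < k)%N by exact: fingraph.order_gt0.
have halfk : (0 < k./2 < k)%N.
  have h_gt0 : (0 < k./2)%N.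
    by rewrite lt0n; apply: contraTneq k_gt0 => h0; rewrite evenk h0.
  by rewrite h_gt0 {2}evenk -addn1 leq_add2l.
exists (iter k./2 phi p).
  split; last exact: fconnect_iter.
    case/andP: halfk => h_gt0 /findex_iter E; apply: contraTneq h_gt0 => Ep.
    by rewrite -E Ep findex0.
  apply: (@iter_inj k./2); rewrite dihedral_flip_iter nup -iterD -evenk.
  by rewrite iterk.
(* A point phi^j p fixed by [nu] satisfies phi^(2j) p = p; with 0 < j < k this forces 2j = k. *)
move=> q qp nuq pq; have ltqk : (findex phi p q < k)%N := findex_max pq.
have := dihedral_flip_iter (findex phi p q) p.
rewrite iter_findex // nuq nup -{2}(iter_findex pq) -iterD.
set j := findex phi p q in ltqk *; move=> E.
have j_gt0 : (0 < j)%N by rewrite lt0n findex_eq0 eq_sym.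
suff defj : (j + j = k)%N.
  rewrite -(iter_findex pq) -/j; congr (iter _ _ _).
  by rewrite -defj addnn doubleK.
have [lt2j|ge2j] := ltnP (j + j) k.
  have := findex_iter lt2j; rewrite E findex0; move/eqP.
  by rewrite eq_sym addn_eq0 andbb -leqn0 leqNgt j_gt0.
have E2 : iter (j + j - k) phi p = p.
  by apply: (@iter_inj k); rewrite -iterD subnKC // iterk.
have lt2 : (j + j - k < k)%N.
  by rewrite ltn_subLR // -addnS leq_add // ltnW.
have := findex_iter lt2; rewrite E2 findex0; move/eqP.
by rewrite eq_sym subn_eq0 => le2j; apply/eqP; rewrite eqn_leq le2j.
Qed.

End DihedralOrbits.

(** * The diagram underlying a stacked pair *)

Section Stacking.
Variable n : nat.
Implicit Types X Y Z : diagram n.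

Lemma stack_edge_upper X Y p : stack_edge X Y (upper p) (upper (X p)).
Proof. by apply/orP; left; apply/existsP; exists p; rewrite !eqxx. Qed.

Lemma stack_edge_lower X Y p : stack_edge X Y (lower p) (lower (Y p)).
Proof. by apply/orP; right; apply/existsP; exists p; rewrite !eqxx. Qed.

Lemma stack_edgeP X Y u w : reflect
  ((exists2 p, u = upper p & w = upper (X p)) \/
   (exists2 p, u = lower p & w = lower (Y p))) (stack_edge X Y u w).
Proof.
apply: (iffP orP) => -[]; rewrite ?[X in X -> _]/=.
- by case/existsP => p /andP[/eqP -> /eqP ->]; left; exists p.
- by case/existsP => p /andP[/eqP -> /eqP ->]; right; exists p.
- by case=> p -> ->; left; apply/existsP; exists p; rewrite !eqxx.
- by case=> p -> ->; right; apply/existsP; exists p; rewrite !eqxx.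
Qed.

Lemma stack_connect_sym X Y : connect_sym (stack_edge X Y).
Proof.
apply: sym_connect_sym => u w.
have sub u' w' : stack_edge X Y u' w' -> stack_edge X Y w' u'.
  case/stack_edgeP=> -[p -> ->].
    by rewrite -{2}[p](partnerK X) stack_edge_upper.
  by rewrite -{2}[p](partnerK Y) stack_edge_lower.
by apply/idP/idP; apply: sub.
Qed.

Section Darts.
Variables X Y : diagram n.

(* A dart is a point of X (inl) or of Y (inr); walking through the stacked
   picture alternates the matching moves with the gluing of the middle points. *)
Let dart : finType := (point n + point n)%type.

Let mu (u : dart) : dart :=
  match u with inl p => inl (X p) | inr p => inr (Y p) end.

Let nu (u : dart) : dart :=
  match u with
  | inl (inr i) => inr (inl i)
  | inr (inl i) => inl (inr i)
  | _ => u
  end.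

Let proj (u : dart) : stack_point n :=
  match u with inl p => upper p | inr p => lower p end.

Let lift_outer (p : point n) : dart :=
  match p with inl i => inl (inl i) | inr i => inr (inr i) end.

Let muK : involutive mu.
Proof. by case=> p /=; rewrite partnerK. Qed.

Let nuK : involutive nu.
Proof. by case=> -[]. Qed.

Let mu_neq u : mu u != u.
Proof.
by case: u => p; apply/eqP => -[] /eqP; rewrite (negPf (partner_neq _ _)).
Qed.

Let nu_outer p : nu (lift_outer p) = lift_outer p.
Proof. by case: p. Qed.

Let nu_fixed u : nu u = u -> exists p, u = lift_outer p.
Proof.
case: u => -[] i // _; [by exists (inl i) | by exists (inr i)].
Qed.

Let lift_outer_inj : injective lift_outer.
Proof. by case=> i [] j // [->]. Qed.

Let proj_eq u w : proj u = proj w -> w = u \/ w = nu u.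
Proof. by case: u => -[] i; case: w => -[] j //= [->]; auto. Qed.

Let proj_nu u : proj (nu u) = proj u.
Proof. by case: u => -[]. Qed.

(** The fibres of [proj] are the orbits of [nu], and the [phi]-orbit of an outer dart is stable
    under [mu] and [nu]. Hence a path in the picture lifts, edge by edge, to that orbit. *)
Lemma connect_outer p q :
  connect (stack_edge X Y) (outer p) (outer q) =
  fconnect (fun u => nu (mu u)) (lift_outer p) (lift_outer q).
Proof.
have projo r : proj (lift_outer r) = outer r by case: r.
apply/idP/idP.
  have [r] : exists2 u, proj u = outer p &
      fconnect (fun u => nu (mu u)) (lift_outer p) u.
    by exists (lift_outer p).
  move=> pr pcr; rewrite -pr => /connectP[s].
  elim: s r pcr {pr} => [|w s IHs] r pcr /=.
    move=> _ /esym; rewrite -projo; case/proj_eq=> -> //.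
    exact: dihedral_connect_nu.
  case/andP=> rw; have [r' <- pcr'] : exists2 r', proj r' = w &
      fconnect (fun u => nu (mu u)) (lift_outer p) r'.
    have stepP (t : dart) : proj t = proj r ->
        fconnect (fun u => nu (mu u)) (lift_outer p) (mu t).
      move=> tr; apply: dihedral_connect_mu => //.
      by case/esym/proj_eq: tr => -> //; apply: dihedral_connect_nu.
    case/stack_edgeP: rw => -[t Er ->].
      by exists (inl (X t)) => //; apply: (stepP (inl t)).
    by exists (inr (Y t)) => //; apply: (stepP (inr t)).
  exact: IHs.
rewrite -!projo => /iter_findex <-; elim: (findex _ _ _) => [|j IHj] //=.
apply: connect_trans IHj _; rewrite proj_nu; apply: connect1.
case: (iter _ _ _) => r /=; [exact: stack_edge_upper|exact: stack_edge_lower].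
Qed.

(** The outer points are the darts fixed by [nu], so by [dihedral_fixed] the component of an outer
    point contains exactly one other outer point; these pairs form [Z]. *)
Lemma stacking_exists : exists Z, is_stacking X Y Z.
Proof.
pose R p q := (p != q) && connect (stack_edge X Y) (outer p) (outer q).
have R_sym p q : R p q = R q p by rewrite /R eq_sym stack_connect_sym.
have Rex p : exists q, R p q /\ forall q', R p q' -> q' = q.
  have [q [qp nuq pq] uniq] := dihedral_fixed muK nuK mu_neq (nu_outer p).
  have [r defr] := nu_fixed nuq.
  exists r; split=> [|q' /andP[pq' cpq']].
    rewrite /R connect_outer -defr pq andbT; apply: contra qp => /eqP ->.
    by rewrite defr.
  apply: lift_outer_inj; rewrite -defr; apply: uniq => //.
    by rewrite (inj_eq lift_outer_inj) eq_sym.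
  by rewrite -connect_outer.
(* The default [p] is never taken, since [Rex] supplies a partner. *)
pose z := [ffun p => odflt p [pick q | R p q]].
have zP p q : (z p == q) = R p q.
  have [r [pr uniq]] := Rex p; rewrite ffunE.
  case: pickP => [r' /uniq -> /=|/(_ r)]; last by rewrite pr.
  by apply/eqP/idP => [<- //|/uniq].
have zM : is_matching z.
  apply/is_matchingP => p; have := zP p (z p); rewrite eqxx => /esym Rz.
  split; first by rewrite eq_sym; case/andP: Rz.
  by apply/eqP; rewrite zP R_sym.
by exists (Diagram zM); apply/forallP => p; apply/forallP => q; rewrite [_ p == q]zP.
Qed.

End Darts.

(** * Colourings of strand ends and of stacked pictures *)

Definition coloring := {ffun 'I_n -> bool}.
Implicit Types a b c : coloring.

Definition glue a c (p : point n) : bool :=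
  match p with inl i => a i | inr i => c i end.

(** The entry at row [a] and column [c] of the matrix by which [X] acts on the n-th tensor power of
    a two-dimensional space. *)
Definition compat X a c : bool := [forall p, glue a c (X p) == glue a c p].

Lemma compatP X a c :
  reflect (forall p, glue a c (X p) = glue a c p) (compat X a c).
Proof. exact: 'forall_eqP. Qed.

(** Colour the two ends of one strand of [X] true and all other points false: if [Y] accepts this
    colouring, it has the same strand. *)
Lemma compat_inj X Y : compat X =2 compat Y -> X = Y.
Proof.
move=> XY; apply: val_inj; apply/ffunP => p /=.
pose a := [ffun i => (inl i == p) || (inl i == X p)] : coloring.
pose c := [ffun i => (inr i == p) || (inr i == X p)] : coloring.
have glueE q : glue a c q = (q == p) || (q == X p) by case: q => i /=; rewrite ffunE.
have /compatP/(_ p) : compat Y a c.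
  rewrite -XY; apply/compatP => q; rewrite !glueE (inj_eq (inv_inj (partnerK X))).
  by rewrite orbC (can2_eq (partnerK X) (partnerK X)).
by rewrite !glueE eqxx (negPf (partner_neq _ _)) /= => /eqP.
Qed.

Section Count.
Variables X Y Z : diagram n.
Hypothesis XYZ : is_stacking X Y Z.
Variables a c : coloring.

Let e := stack_edge X Y.

Let col b (u : stack_point n) : bool :=
  match u with inl (inl i) => a i | inl (inr i) => b i | inr i => c i end.

Let col_outer b p : col b (outer p) = glue a c p. Proof. by case: p. Qed.

Let col_upper b p : col b (upper p) = glue a b p. Proof. by case: p. Qed.

Let col_lower b p : col b (lower p) = glue b c p. Proof. by case: p. Qed.

Let goodP b : reflect (forall u w, connect e u w -> col b u = col b w)
  (compat X a b && compat Y b c).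
Proof.
apply: (iffP andP) => [[/compatP Xab /compatP Ybc] u w|con].
  case/connectP=> s; elim: s u => [|w' s IHs] u /=; first by move=> _ ->.
  case/andP=> uw' /IHs H /H <-.
  by case/stack_edgeP: uw' => -[p -> ->]; rewrite ?col_upper ?col_lower ?Xab ?Ybc.
split; apply/compatP => p.
  by rewrite -!col_upper; apply/esym/con/connect1/stack_edge_upper.
by rewrite -!col_lower; apply/esym/con/connect1/stack_edge_lower.
Qed.

Let stackE p q : (Z p == q) = (p != q) && connect e (outer p) (outer q).
Proof. exact: (eqP (forallP (forallP XYZ p) q)). Qed.

Let closed_loop w := [forall p, ~~ connect e w (outer p)].

Let eC : connect_sym e := stack_connect_sym X Y.

(** A middle colouring is admissible when the whole picture is coloured constantly on components.
    Components with outer points take their colour from [a] and [c], consistently exactly when [Z]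
    accepts these; each closed loop is free and contributes a factor 2. *)
Lemma count_compat :
  (\sum_(b : coloring) compat X a b * compat Y b c =
   2 ^ loops X Y * compat Z a c)%N.
Proof.
under eq_bigr do rewrite mulnb.
have -> : (\sum_b (compat X a b && compat Y b c) =
    #|[set b : coloring | compat X a b && compat Y b c]|)%N.
  rewrite -sum1_card [RHS]big_mkcond; apply: eq_bigr => b _.
  by rewrite inE; case: (_ && _).
set B := [set b | _].
have [Zac|/compatP nZac] := boolP (compat Z a c); last first.
  rewrite muln0; apply/eqP; rewrite cards_eq0; apply/eqP/setP => b.
  rewrite !inE; apply/goodP => con; apply: nZac => p.
  rewrite -!(col_outer b); apply: con; rewrite eC.
  by have := stackE p (Z p); rewrite eqxx => /esym/andP[].
rewrite muln1; pose L := [set x | roots e x && closed_loop x].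
have cardL : #|L| = loops X Y.
  by rewrite cardsE; apply: eq_card => x; rewrite !inE.
rewrite -cardL -card_powerset.
(* An admissible colouring is encoded by the closed loops, named by their roots, that it colours
   true; this matches [B] with the subsets of [L]. *)
pose trace b := [set x in L | col b x].
have closedE u w : connect e u w -> closed_loop u = closed_loop w.
  move=> uw; apply: eq_forallb => p; congr negb.
  exact: same_connect.
have injt : {in B &, injective trace}.
  move=> b b'; rewrite !inE => /goodP gb /goodP gb' tbb'; apply/ffunP => i.
  pose x : stack_point n := inl (inr i); rewrite -[LHS]/(col b x) -[RHS]/(col b' x).
  have [lx|] := boolP (closed_loop x).
    have rootL : fingraph.root e x \in L.
      by rewrite inE roots_root //= -(closedE x) ?connect_root.
    rewrite (gb _ _ (connect_root e x)) (gb' _ _ (connect_root e x)).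
    by have /setP/(_ (fingraph.root e x)) := tbb'; move: rootL; rewrite !inE => ->.
  rewrite negb_forall => /existsP[p /negPn xp].
  by rewrite (gb _ _ xp) (gb' _ _ xp) !col_outer.
rewrite -(card_in_imset injt); apply: eq_card => A.
rewrite powersetE; apply/imsetP/idP => [[b _ ->]|AL].
  by apply/subsetP => x; rewrite inE => /andP[].
(* This inverts [trace]: a loop takes its colour from [A], any other component from one of its outer
   points, whose choice is immaterial by [Zac]. The final [false] is never reached. *)
pose F u := if closed_loop u then fingraph.root e u \in A
  else if [pick p | connect e u (outer p)] is Some p then glue a c p else false.
have Fcon u w : connect e u w -> F u = F w.
  move=> uw; rewrite /F (closedE _ _ uw) (fingraph.rootP eC uw).
  case: ifP => // _; congr (match _ with Some p => _ | None => _ end).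
  by apply: eq_pick => p; apply: same_connect.
have Fouter p : F (outer p) = glue a c p.
  rewrite /F ifF; last first.
    by apply/negbTE; rewrite negb_forall; apply/existsP; exists p; rewrite connect0.
  case: pickP => [q pq|/(_ p)]; last by rewrite connect0.
  have [-> //|npq] := eqVneq p q.
  have /eqP <- : Z p == q by rewrite stackE npq.
  exact: (compatP _ _ _ Zac).
pose b : coloring := [ffun i => F (inl (inr i))].
have colF u : col b u = F u.
  case: u => [[] i|i]; rewrite /= ?ffunE //.
    by have := Fouter (inl i).
  by have := Fouter (inr i).
exists b; first by rewrite inE; apply/goodP => u w; rewrite !colF; apply: Fcon.
apply/setP => x; rewrite inE colF; apply/idP/andP => [xA|[]].
  have xL := subsetP AL x xA; split=> //.
  by move: xL; rewrite inE /F => /andP[/eqP -> ->].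
by rewrite inE /F => /andP[/eqP -> ->].
Qed.

End Count.

End Stacking.

(** * The algebra of diagrams *)

Lemma compat_id n : compat (id_diag n) =2 eq_op.
Proof.
move=> a c; apply/compatP/eqP => [ac|-> [] i]; rewrite ?ffunE //.
by apply/ffunP => i; have := ac (inr i); rewrite ffunE.
Qed.

Definition color_mul n (F G : coloring n -> coloring n -> nat) a c : nat :=
  (\sum_b F a b * G b c)%N.

Lemma eq_color_mul n (F F' G G' : coloring n -> coloring n -> nat) :
  F =2 F' -> G =2 G' -> color_mul F G =2 color_mul F' G'.
Proof. by move=> FF' GG' a c; apply: eq_bigr => b _; rewrite FF' GG'. Qed.

Lemma color_mul_scale n (F G : coloring n -> coloring n -> nat) k l :
  color_mul (fun a c => k * F a c)%N (fun a c => l * G a c)%N =2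
  (fun a c => k * l * color_mul F G a c)%N.
Proof.
by move=> a c; rewrite /color_mul big_distrr; apply: eq_bigr => b _; rewrite mulnACA.
Qed.

Lemma color_mulA n (F G H : coloring n -> coloring n -> nat) :
  color_mul F (color_mul G H) =2 color_mul (color_mul F G) H.
Proof.
move=> a c; rewrite /color_mul; under eq_bigr do rewrite big_distrr.
rewrite exchange_big; apply: eq_bigr => b _; rewrite big_distrl.
by apply: eq_bigr => b' _; rewrite /= mulnA.
Qed.

(** The all-true colouring is accepted by every diagram, so that entry compares the powers of 2;
    after cancelling them, [compat_inj] applies. *)
Lemma compat_scale_inj n (X Y : diagram n) k l :
  (forall a c, 2 ^ k * compat X a c = 2 ^ l * compat Y a c)%N ->
  k = l /\ X = Y.
Proof.
have compat1 (Z : diagram n) : compat Z [ffun=> true] [ffun=> true].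
  by apply/compatP => p; case: p (Z p) => i [] j; rewrite /= !ffunE.
move=> E; have := E [ffun=> true] [ffun=> true].
rewrite !compat1 !muln1 => /eqP; rewrite eqn_exp2l // => /eqP kl.
split=> //; apply: compat_inj => a c; have := E a c; rewrite kl => /eqP.
by rewrite eqn_pmul2l ?expn_gt0 //; case: (compat X a c); case: (compat Y a c).
Qed.

Local Open Scope ring_scope.

Section Monomials.
Variables (K : fieldType) (d : K).

Section Size.
Variable n : nat.
Implicit Types (u v w : VTL d n) (X Y Z : diagram n).

Lemma basis_sum u : u = \sum_X u X *: basis_elt d X.
Proof.
apply/ffunP => Y; rewrite sum_ffunE (bigD1 Y) //= big1 => [|X XY].
  by rewrite !ffunE eqxx addr0 [_ *: _]mulr1.
by rewrite !ffunE (negPf XY) [_ *: _]mulr0.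
Qed.

Lemma VTL_linear_ind (P : VTL d n -> Prop) :
  (forall u v, P u -> P v -> P (u + v)) -> (forall k u, P u -> P (k *: u)) ->
  (forall X, P (basis_elt d X)) -> forall u, P u.
Proof.
move=> PD PZ Pb u; rewrite (basis_sum u); apply: big_ind => //.
  by rewrite -(scale0r (one_VTL d n)); apply: PZ; apply: Pb.
by move=> X _; apply: PZ.
Qed.

Lemma mul_VTLDl : left_distributive (@mul_VTL K d n) +%R.
Proof.
move=> u v w; rewrite /mul_VTL -big_split; apply: eq_bigr => X _.
rewrite -big_split; apply: eq_bigr => Y _; rewrite -big_split.
by apply: eq_bigr => Z _; rewrite ffunE /= -scalerDl !mulrDl.
Qed.

Lemma mul_VTLDr : right_distributive (@mul_VTL K d n) +%R.
Proof.
move=> w u v; rewrite /mul_VTL -big_split; apply: eq_bigr => X _.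
rewrite -big_split; apply: eq_bigr => Y _; rewrite -big_split.
by apply: eq_bigr => Z _; rewrite ffunE /= -scalerDl mulrDr mulrDl.
Qed.

Lemma scale_mul_VTLl k u v : k *: (u *v v) = (k *: u) *v v.
Proof.
rewrite /mul_VTL scaler_sumr; apply: eq_bigr => X _; rewrite scaler_sumr.
apply: eq_bigr => Y _; rewrite scaler_sumr; apply: eq_bigr => Z _.
by rewrite ffunE scalerA -![_ *: u X]/(_ * _) !mulrA.
Qed.

Lemma scale_mul_VTLr k u v : k *: (u *v v) = u *v (k *: v).
Proof.
rewrite /mul_VTL scaler_sumr; apply: eq_bigr => X _; rewrite scaler_sumr.
apply: eq_bigr => Y _; rewrite scaler_sumr; apply: eq_bigr => Z _.
by rewrite ffunE scalerA -![_ *: v Y]/(_ * _) !mulrA [k * _]mulrC.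
Qed.

(** [is_stacking] determines [Z], so the triple sum collapses to one term. *)
Lemma basis_mul X Y Z : is_stacking X Y Z ->
  basis_elt d X *v basis_elt d Y = d ^+ loops X Y *: basis_elt d Z.
Proof.
move=> XYZ; rewrite /mul_VTL (bigD1 X) //= [X in _ + X]big1 ?addr0; last first.
  move=> X' X'X; rewrite big1 // => Y' _; rewrite big1 // => Z' _.
  by rewrite ffunE eq_sym (negPf X'X) !mul0r scale0r.
rewrite (bigD1 Y) //= [X in _ + X]big1 ?addr0; last first.
  move=> Y' Y'Y; rewrite big1 // => Z' _.
  by rewrite [basis_elt d Y _]ffunE eq_sym (negPf Y'Y) mulr0 mul0r scale0r.
rewrite (big_pred1 Z) => [|Z']; first by rewrite !ffunE !eqxx !mul1r.
apply/idP/eqP => [XYZ'|-> //]; apply: val_inj; apply/ffunP => p /=.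
have /forallP/(_ p)/forallP/(_ (Z p))/eqP := XYZ.
have /forallP/(_ p)/forallP/(_ (Z p))/eqP := XYZ'.
by rewrite eqxx => E1 E2; apply/eqP; rewrite E1 -E2.
Qed.

(* The monomial d ^ l Z is recorded by its action on two-dimensional tensor
   space, where the parameter is 2; this determines both l and Z. *)
Definition rep u (F : coloring n -> coloring n -> nat) : Prop :=
  exists l Z, u = d ^+ l *: basis_elt d Z /\
    forall a c, F a c = (2 ^ l * compat Z a c)%N.

(** The transfer principle: an identity between products of diagrams follows from the matrix
    identity at parameter 2. *)
Lemma rep_inj u v F G : rep u F -> rep v G -> F =2 G -> u = v.
Proof.
move=> [k [X [-> FX]]] [l [Y [-> GY]]] FG.
by have [|-> ->] := @compat_scale_inj _ X Y k l => // a c; rewrite -FX FG GY.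
Qed.

Lemma rep_ext u F G : rep u F -> F =2 G -> rep u G.
Proof.
by move=> [k [X [-> FX]]] FG; exists k, X; split=> // a c; rewrite -FG FX.
Qed.

Lemma rep_basis X : rep (basis_elt d X) (compat X).
Proof. by exists 0, X; rewrite expr0 scale1r; split=> // a c; rewrite mul1n. Qed.

Lemma rep_mul u v F G : rep u F -> rep v G -> rep (u *v v) (color_mul F G).
Proof.
move=> [k [X [-> FX]]] [l [Y [-> GY]]]; have [Z XYZ] := stacking_exists X Y.
exists (k + l + loops X Y)%N, Z; split=> [|a c].
  by rewrite -scale_mul_VTLl -scale_mul_VTLr (basis_mul XYZ) !scalerA !exprD.
rewrite (eq_color_mul FX GY) color_mul_scale /color_mul (count_compat XYZ) !expnD.
by rewrite mulnA.
Qed.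

Lemma rep_scale u F : rep u F -> rep (d *: u) (fun a c => 2 * F a c)%N.
Proof.
move=> [k [X [-> FX]]]; exists k.+1, X; rewrite exprS scalerA; split=> // a c.
by rewrite FX mulnA expnS.
Qed.

(** Linearity in each factor reduces this to diagrams, where it is associativity of the matrix
    product. *)
Lemma mul_VTLA : associative (@mul_VTL K d n).
Proof.
elim/VTL_linear_ind => [u u' IHu IHu' v w|k u IHu v w|X].
- by rewrite !mul_VTLDl IHu IHu'.
- by rewrite -!scale_mul_VTLl IHu.
elim/VTL_linear_ind => [v v' IHv IHv' w|k v IHv w|Y].
- by rewrite !(mul_VTLDl, mul_VTLDr) IHv IHv'.
- by rewrite -scale_mul_VTLr -!scale_mul_VTLl -scale_mul_VTLr IHv.
elim/VTL_linear_ind => [w w' IHw IHw'|k w IHw|Z].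
- by rewrite !mul_VTLDr IHw IHw'.
- by rewrite -!scale_mul_VTLr IHw.
have rb := rep_basis; apply: rep_inj (@color_mulA _ _ _ _).
  exact: rep_mul (rb _) (rep_mul (rb _) (rb _)).
exact: rep_mul (rep_mul (rb _) (rb _)) (rb _).
Qed.

Lemma mul_VTL1l : left_id (one_VTL d n) (@mul_VTL K d n).
Proof.
elim/VTL_linear_ind => [u v IHu IHv|k u IHu|X].
- by rewrite mul_VTLDr IHu IHv.
- by rewrite -scale_mul_VTLr IHu.
have rb := rep_basis; apply: rep_inj (rep_mul (rb _) (rb _)) (rb _) _ => a c.
rewrite /color_mul (bigD1 a) //= compat_id eqxx mul1n big1 ?addn0 // => b ba.
by rewrite compat_id eq_sym (negPf ba).
Qed.

Lemma mul_VTL1r : right_id (one_VTL d n) (@mul_VTL K d n).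
Proof.
elim/VTL_linear_ind => [u v IHu IHv|k u IHu|X].
- by rewrite mul_VTLDl IHu IHv.
- by rewrite -scale_mul_VTLl IHu.
have rb := rep_basis; apply: rep_inj (rep_mul (rb _) (rb _)) (rb _) _ => a c.
rewrite /color_mul (bigD1 c) //= compat_id eqxx muln1 big1 ?addn0 // => b bc.
by rewrite compat_id (negPf bc) muln0.
Qed.

Lemma one_VTL_neq0 : one_VTL d n != 0.
Proof.
by apply/eqP => /ffunP/(_ (id_diag n))/eqP; rewrite !ffunE eqxx oner_eq0.
Qed.

(** From here on [*] and [1] on [VTL d n] are the diagram product and the identity diagram. *)
HB.instance Definition _ := GRing.Zmodule_isNzRing.Build (VTL d n)
  mul_VTLA mul_VTL1l mul_VTL1r mul_VTLDl mul_VTLDr one_VTL_neq0.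
HB.instance Definition _ := GRing.Lmodule_isLalgebra.Build K (VTL d n)
  scale_mul_VTLl.
HB.instance Definition _ := GRing.Lalgebra_isAlgebra.Build K (VTL d n)
  scale_mul_VTLr.

End Size.
End Monomials.

(** * Colourings of strands *)

Lemma tperm_neq (T : finType) (x y z : T) : z != x -> z != y -> tperm x y z = z.
Proof. by rewrite ![z == _]eq_sym; apply: tpermD. Qed.

Section LocalColorings.
Variable n : nat.
Implicit Types (p q r : 'I_n) (s : 'S_n) (a b c : coloring n).

Definition permute s a : coloring n := [ffun j => a (s j)].

Lemma permuteM s t a : permute (s * t)%g a = permute s (permute t a).
Proof. by apply/ffunP => j; rewrite !ffunE permM. Qed.

Lemma permute1 a : permute 1%g a = a.
Proof. by apply/ffunP => j; rewrite ffunE perm1. Qed.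

Lemma permuteK s : cancel (permute s) (permute s^-1%g).
Proof. by move=> a; rewrite -permuteM mulVg permute1. Qed.

Lemma permuteKV s : cancel (permute s^-1%g) (permute s).
Proof. by move=> a; rewrite -permuteM mulgV permute1. Qed.

Definition perm_fun s : {ffun point n -> point n} :=
  [ffun p => match p with inl j => inr (s j) | inr j => inl (s^-1%g j) end].

Lemma perm_fun_matching s : is_matching (perm_fun s).
Proof. by apply/is_matchingP => -[] i; rewrite !ffunE ?permK ?permKV. Qed.

(** Top [j] is joined to bottom [s j]; as permutations compose from left to right, stacking these
    diagrams follows the order of the group product. *)
Definition perm_diag s : diagram n := Diagram (perm_fun_matching s).

Lemma compat_perm s a c : compat (perm_diag s) a c = (a == permute s c).
Proof.
apply/compatP/eqP => [ac|-> [] i]; rewrite ?ffunE /= ?ffunE ?permKV //.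
by apply/ffunP => i; have := ac (inl i); rewrite !ffunE.
Qed.

Lemma color_mul_perml s F a c :
  color_mul (fun a c => compat (perm_diag s) a c : nat) F a c =
  F (permute s^-1%g a) c.
Proof.
rewrite /color_mul (bigD1 (permute s^-1%g a)) //= compat_perm permuteKV eqxx mul1n.
rewrite big1 ?addn0 // => b ba; rewrite compat_perm [a == _]eq_sym.
by rewrite (can2_eq (permuteK s) (permuteKV s)) (negPf ba).
Qed.

Lemma color_mul_permr s F a c :
  color_mul F (fun a c => compat (perm_diag s) a c : nat) a c = F a (permute s c).
Proof.
rewrite /color_mul (bigD1 (permute s c)) //= compat_perm eqxx muln1.
by rewrite big1 ?addn0 // => b bc; rewrite compat_perm (negPf bc) muln0.
Qed.

(** The matrix of the diagram with one arc at the top and one at the bottom, both joining [p] and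
    [q], and vertical strands elsewhere. The positions are arbitrary so that conjugates of the e_i
    by permutations are covered. *)
Definition cap p q a c : bool :=
  [&& a p == a q, c p == c q & [forall j, (j != p) ==> (j != q) ==> (a j == c j)]].

Lemma capP p q a c : reflect
  [/\ a p = a q, c p = c q & forall j, j != p -> j != q -> a j = c j] (cap p q a c).
Proof.
apply: (iffP and3P) => [[/eqP apq /eqP cpq /forallP H]|[apq cpq H]]; split=> //.
- by move=> j jp jq; have := H j; rewrite jp jq => /eqP.
- exact/eqP.
- exact/eqP.
by apply/forallP => j; apply/implyP => jp; apply/implyP => jq; apply/eqP/H.
Qed.

Lemma cap_sym p q a c : cap p q a c = cap p q c a.
Proof. by apply/capP/capP => -[pq pq' H]; split=> // j jp jq; rewrite H. Qed.

Lemma cap_permute s p q a c :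
  cap p q (permute s a) (permute s c) = cap (s p) (s q) a c.
Proof.
apply/capP/capP; rewrite !ffunE => -[pq pq' H]; split=> // j jp jq.
  have := H (s^-1%g j); rewrite !ffunE permKV; apply.
    by rewrite -(inj_eq (@perm_inj _ s)) permKV.
  by rewrite -(inj_eq (@perm_inj _ s)) permKV.
by rewrite !ffunE H // (inj_eq perm_inj).
Qed.

Definition recolor p q (t : bool) a : coloring n :=
  [ffun j => if (j == p) || (j == q) then t else a j].

(** Given [a], the colouring [b] is determined away from [p] and [q], and its common colour [t]
    there is free. *)
Lemma cap_recolor p q a b :
  (cap p q a b = (a p == a q) * \sum_t (b == recolor p q t a) :> nat)%N.
Proof.
rewrite (bigD1 (b p)) //= big1 ?addn0 => [|t tb]; last first.
  apply/eqP; rewrite eqb0; apply: contra tb => /eqP ->.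
  by rewrite ffunE eqxx.
rewrite mulnb; congr nat_of_bool; apply/capP/andP => [[-> bpq H]|[/eqP apq /eqP bE]].
  split=> //; apply/eqP/ffunP => j; rewrite ffunE.
  have [->//|jp] := eqVneq j p; have [->//|jq] := eqVneq j q.
  by rewrite H.
split=> //; first by rewrite bE !ffunE !eqxx orbT.
by move=> j jp jq; rewrite bE ffunE (negPf jp) (negPf jq).
Qed.

Lemma color_mul_capl p q F a c :
  (color_mul (fun a c => cap p q a c : nat) F a c =
   (a p == a q) * \sum_t F (recolor p q t a) c)%N.
Proof.
rewrite /color_mul; under eq_bigr do rewrite cap_recolor -mulnA big_distrl.
rewrite -big_distrr exchange_big; congr muln; apply: eq_bigr => t _.
rewrite (bigD1 (recolor p q t a)) //= eqxx mul1n big1 ?addn0 // => b bu.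
by rewrite (negPf bu).
Qed.

Lemma color_mul_transpose (F F' G G' : coloring n -> coloring n -> nat) a c :
  (forall a c, F a c = F' c a) -> (forall a c, G a c = G' c a) ->
  color_mul F G a c = color_mul G' F' c a.
Proof. by move=> FF' GG'; apply: eq_bigr => b _; rewrite FF' GG' mulnC. Qed.

Lemma color_mul_capr p q F a c :
  (color_mul F (fun a c => cap p q a c : nat) a c =
   (c p == c q) * \sum_t F a (recolor p q t c))%N.
Proof.
rewrite (@color_mul_transpose F (fun c a => F a c) _
  (fun a c => cap p q a c : nat)) //.
  by rewrite color_mul_capl.
by move=> a' c'; rewrite cap_sym.
Qed.

(** The colour of the middle arcs is free: its two values account for the closed loop. *)
Lemma color_mul_cap_loop p q :
  color_mul (fun a c => cap p q a c : nat) (fun a c => cap p q a c : nat) =2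
  (fun a c => 2 * cap p q a c)%N.
Proof.
move=> a c; rewrite color_mul_capl; have capE t : (a p == a q) ->
  cap p q (recolor p q t a) c = cap p q a c.
  move=> /eqP apq; apply/capP/capP; rewrite !ffunE !eqxx !orbT /=;
  move=> -[_ cpq H]; split=> // j jp jq;
  by have := H j jp jq; rewrite ffunE (negPf jp) (negPf jq).
have [apq|napq] := boolP (a p == a q).
  by rewrite big_bool /= !capE // mul1n mul2n addnn.
by rewrite mul0n /cap (negPf napq) muln0.
Qed.

Lemma cap_tperm p q a c : cap p q (permute (tperm p q) a) c = cap p q a c.
Proof.
apply/capP/capP; rewrite !ffunE tpermL tpermR => -[-> -> H]; split=> // j jp jq;
by have := H j jp jq; rewrite ffunE tperm_neq.
Qed.

(** The matrix form of e_j v_i e_j = e_j for j = i+1; only the summand [t = a p] survives. *)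
Lemma cap_tperm_cap p q r a c : p != q -> p != r -> q != r ->
  ((a q == a r) * \sum_t cap q r (permute (tperm p q) (recolor q r t a)) c =
   cap q r a c)%N.
Proof.
move=> pq pr qr; have [rq rp qp] : [/\ r != q, r != p & q != p].
  by rewrite ![r == _]eq_sym [q == p]eq_sym.
rewrite (bigD1 (a p)) //= big1 ?addn0 => [|t tb]; last first.
  apply/eqP; rewrite eqb0; apply: contra tb => /capP[+ _ _].
  rewrite !ffunE tpermR tpermD // eqxx orbT /=.
  by rewrite (negPf pq) (negPf pr) /= => ->.
rewrite mulnb; congr nat_of_bool.
apply/andP/capP => [[/eqP aqr /capP[_ cqr H]]|[aqr cqr H]].
  split=> // j jq jr; have := H j jq jr; rewrite !ffunE.
  have [->|jp] := eqVneq j p; first by rewrite tpermL eqxx.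
  by rewrite tperm_neq // (negPf jq) (negPf jr).
split; first exact/eqP.
apply/capP; split=> // [|j jq jr].
  by rewrite !ffunE tpermR tpermD // (negPf pq) (negPf pr) eqxx orbT.
rewrite !ffunE; have [->|jp] := eqVneq j p; first by rewrite tpermL eqxx H.
by rewrite tperm_neq // (negPf jq) (negPf jr) /= H.
Qed.

(** The matrix form of v_j v_i e_j = e_i e_j for j = i+1; only the summand [t = a r] survives. *)
Lemma cap_tperm2 p q r a c : p != q -> p != r -> q != r ->
  (cap q r (permute (tperm p q) (permute (tperm q r) a)) c =
   (a p == a q) * \sum_t cap q r (recolor p q t a) c :> nat)%N.
Proof.
move=> pq pr qr; have [rq rp qp] : [/\ r != q, r != p & q != p].
  by rewrite ![r == _]eq_sym [q == p]eq_sym.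
rewrite (bigD1 (a r)) //= big1 ?addn0 => [|t tb]; last first.
  apply/eqP; rewrite eqb0; apply: contra tb => /capP[+ _ _].
  by rewrite !ffunE eqxx orbT (negPf rp) (negPf rq) => /= ->.
rewrite mulnb; congr nat_of_bool; pose E := (tpermL, tpermR).
have atq : tperm p q r = r by rewrite tpermD.
have atp : tperm q r p = p by rewrite tpermD.
apply/capP/andP; rewrite !ffunE atq !E atp => -[].
  move=> apq cqr H; split; first exact/eqP.
  apply/capP; rewrite !ffunE eqxx orbT (negPf rp) (negPf rq) /=; split=> // j jq jr.
  have := H j jq jr; rewrite !ffunE (negPf jq) orbF.
  have [->|jp] := eqVneq j p; first by rewrite !E.
  by rewrite !tperm_neq.
move/eqP=> apq /capP[_ cqr H]; split=> // j jq jr; have := H j jq jr.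
rewrite !ffunE (negPf jq) orbF.
have [->|jp] := eqVneq j p; first by rewrite !E.
by rewrite !tperm_neq.
Qed.

End LocalColorings.

(** * Generators and the added strand *)

Section Generators.
Variables (K : fieldType) (d : K).

Lemma pos_neq n (i : 'I_n) : pos i != pos_succ i.
Proof. by rewrite -val_eqE /= /bump /= neq_ltn ltnSn. Qed.

Definition gen_perm n (i : 'I_n) : 'S_n.+1 := tperm (pos i) (pos_succ i).

Lemma v_diagE n (i : 'I_n) : v_diag i = perm_diag (gen_perm i).
Proof.
by apply: val_inj; apply/ffunP => -[] j; rewrite !ffunE //= /gen_perm tpermV.
Qed.

Lemma compat_e n (i : 'I_n) a c :
  compat (e_diag i) a c = cap (pos i) (pos_succ i) a c.
Proof.
apply/compatP/capP => [ac|[apq cpq H]].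
  split=> [| |j jp jq].
  - by have := ac (inl (pos i)); rewrite ffunE /= eqxx /= tpermL.
  - by have := ac (inr (pos i)); rewrite ffunE /= eqxx /= tpermL.
  by have := ac (inr j); rewrite ffunE /= (negPf jp) (negPf jq) /=.
have HA (b : coloring n.+1) :
    b (pos i) = b (pos_succ i) -> forall j, b (gen_perm i j) = b j.
  by move=> bpq j; rewrite /gen_perm; case: tpermP => [->|->|].
case=> j; rewrite ffunE /=; case: ifP => [_|/norP[jp jq]] /=.
- exact: HA.
- by rewrite H.
- exact: HA.
- exact: H.
Qed.

Lemma rep_e n (i : 'I_n) : rep (gen_e d i) (fun a c => cap (pos i) (pos_succ i) a c).
Proof. by apply: rep_ext (rep_basis d _) _ => a c; rewrite compat_e. Qed.

Lemma rep_v n (i : 'I_n) :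
  rep (gen_v d i) (fun a c => compat (perm_diag (gen_perm i)) a c).
Proof. by rewrite /gen_v v_diagE; apply: rep_basis. Qed.

Lemma rep_mulr n (u v : VTL d n) F G :
  rep u F -> rep v G -> rep (u * v) (color_mul F G).
Proof. exact: rep_mul. Qed.

Lemma gen_ee n (i : 'I_n) : gen_e d i * gen_e d i = d *: gen_e d i.
Proof.
have re := rep_e i; apply: rep_inj (rep_mulr re re) (rep_scale re) _.
exact: color_mul_cap_loop.
Qed.

Lemma gen_ve n (i : 'I_n) : gen_v d i * gen_e d i = gen_e d i.
Proof.
have re := rep_e i; apply: rep_inj (rep_mulr (rep_v i) re) re _ => a c.
by rewrite color_mul_perml tpermV cap_tperm.
Qed.

Lemma gen_ev n (i : 'I_n) : gen_e d i * gen_v d i = gen_e d i.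
Proof.
have re := rep_e i; apply: rep_inj (rep_mulr re (rep_v i)) re _ => a c.
by rewrite color_mul_permr cap_sym cap_tperm cap_sym.
Qed.

Lemma mul_basis_perm n s t :
  basis_elt d (perm_diag s) * basis_elt d (perm_diag t) =
  basis_elt d (perm_diag (s * t)%g) :> VTL d n.
Proof.
have rb := rep_basis d; apply: rep_inj (rep_mulr (rb _ _) (rb _ _)) (rb _ _) _ => a c.
by rewrite color_mul_permr !compat_perm permuteM.
Qed.

Lemma basis_perm1 n : basis_elt d (perm_diag 1%g) = 1 :> VTL d n.
Proof.
congr basis_elt; apply: val_inj; apply/ffunP => -[] i; rewrite !ffunE ?invg1 perm1 //.
Qed.

Lemma gen_vE n (i : 'I_n) : gen_v d i = basis_elt d (perm_diag (gen_perm i)).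
Proof. by rewrite /gen_v v_diagE. Qed.

Lemma gen_vv n (i : 'I_n) : gen_v d i * gen_v d i = 1.
Proof. by rewrite gen_vE mul_basis_perm tperm2 basis_perm1. Qed.

(** * Relations between adjacent generators *)

Section Adjacent.
Variables (n : nat) (i j : 'I_n).
Hypothesis ij : pos_succ i = pos j.

Let p := pos i.
Let q := pos j.
Let r := pos_succ j.

Let pq : p != q. Proof. by rewrite /q -ij pos_neq. Qed.
Let qr : q != r. Proof. exact: pos_neq. Qed.
Let pr : p != r.
Proof.
have /(congr1 val) := ij; rewrite -val_eqE /= /bump /= add1n => <-.
by rewrite neq_ltn !ltnS leqnSn.
Qed.

Let permE : gen_perm i = tperm p q. Proof. by rewrite /gen_perm ij. Qed.

Let rep_e_i : rep (gen_e d i) (fun a c => cap p q a c).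
Proof. by have := rep_e i; rewrite ij. Qed.

Lemma gen_eve : gen_e d j * gen_v d i * gen_e d j = gen_e d j.
Proof.
have re := rep_e j; rewrite -mulrA.
apply: rep_inj (rep_mulr re (rep_mulr (rep_v i) re)) re _ => a c.
rewrite color_mul_capl -(cap_tperm_cap _ _ pq pr qr); congr muln.
by apply: eq_bigr => t _; rewrite color_mul_perml permE tpermV.
Qed.

Lemma gen_vve : gen_v d j * gen_v d i * gen_e d j = gen_e d i * gen_e d j.
Proof.
have re := rep_e j; rewrite -mulrA.
apply: rep_inj (rep_mulr (rep_v j) (rep_mulr (rep_v i) re)) (rep_mulr rep_e_i re) _.
move=> a c; rewrite color_mul_capl !color_mul_perml permE !tpermV.
exact: (cap_tperm2 _ _ pq pr qr).
Qed.

Lemma gen_evv : gen_e d j * gen_v d i * gen_v d j = gen_e d j * gen_e d i.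
Proof.
have re := rep_e j.
apply: rep_inj (rep_mulr (rep_mulr re (rep_v i)) (rep_v j)) (rep_mulr re rep_e_i) _.
move=> a c; rewrite color_mul_capr !color_mul_permr permE cap_sym.
rewrite (cap_tperm2 _ _ pq pr qr); congr muln; apply: eq_bigr => t _.
by rewrite cap_sym.
Qed.

(** Both sides are the diagram [cap] at the two extreme positions [p] and [r]. *)
Lemma gen_vev :
  gen_v d j * gen_e d i * gen_v d j = gen_v d i * gen_e d j * gen_v d i.
Proof.
have re := rep_e j.
apply: rep_inj (rep_mulr (rep_mulr (rep_v j) rep_e_i) (rep_v j))
  (rep_mulr (rep_mulr (rep_v i) re) (rep_v i)) _ => a c.
rewrite !color_mul_permr !color_mul_perml permE !tpermV !cap_permute tpermL tpermR.
by rewrite !tpermD // eq_sym.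
Qed.

(** Both sides are the transposition of [p] and [r], written as a conjugate in two ways. *)
Lemma gen_vvv :
  gen_v d j * gen_v d i * gen_v d j = gen_v d i * gen_v d j * gen_v d i.
Proof.
rewrite !gen_vE !mul_basis_perm permE; congr (basis_elt _ (perm_diag _)).
have tJ (x y z w : 'I_n.+1) :
    (tperm x y * tperm z w * tperm x y)%g = (tperm z w ^ tperm x y)%g.
  by rewrite conjgE tpermV mulgA.
rewrite !tJ !tpermJ tpermL tpermR !tpermD //; by rewrite eq_sym.
Qed.

End Adjacent.

(** * Adding a strand is a unital algebra morphism *)

Section Inclusion.

Definition restrict n (a : coloring n.+1) : coloring n :=
  [ffun j => a (lift ord_max j)].

Lemma compat_add_strand n (X : diagram n) a c :
  compat (add_strand X) a c =
  compat X (restrict a) (restrict c) && (a ord_max == c ord_max).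
Proof.
have glue_widen p : glue a c (widen_point p) = glue (restrict a) (restrict c) p.
  by case: p => i; rewrite /= ffunE.
have add_widen p : add_strand X (widen_point p) = widen_point (X p).
  by case: p => i; rewrite ffunE /= liftK.
apply/compatP/andP => [ac|[/compatP ac /eqP max]].
  split; last by have := ac (inr ord_max); rewrite ffunE unlift_none => /eqP.
  by apply/compatP => p; rewrite -!glue_widen -add_widen.
case=> j; case: (unliftP ord_max j) => [i|] ->.
- by have := ac (inl i); rewrite -!glue_widen -add_widen.
- by rewrite ffunE unlift_none.
- by have := ac (inr i); rewrite -!glue_widen -add_widen.
- by rewrite ffunE unlift_none.
Qed.

Lemma incl_VTL_linear n : linear (@incl_VTL K d n).
Proof.
move=> k u v; rewrite /incl_VTL scaler_sumr -big_split; apply: eq_bigr => X _.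
by rewrite !ffunE scalerDl scalerA.
Qed.

HB.instance Definition _ n := GRing.isLinear.Build K (VTL d n) (VTL d n.+1) *:%R
  (@incl_VTL K d n) (@incl_VTL_linear n).

Lemma incl_VTLD n (u v : VTL d n) : incl_VTL (u + v) = incl_VTL u + incl_VTL v.
Proof. exact: linearD. Qed.

Lemma incl_VTLZ n k (u : VTL d n) : incl_VTL (k *: u) = k *: incl_VTL u.
Proof. exact: linearZ. Qed.

Lemma incl_basis n (X : diagram n) :
  incl_VTL (basis_elt d X) = basis_elt d (add_strand X).
Proof.
rewrite /incl_VTL (bigD1 X) //= ffunE eqxx scale1r big1 ?addr0 // => Y YX.
by rewrite ffunE eq_sym (negPf YX) scale0r.
Qed.

Lemma rep_incl n (u : VTL d n) F : rep u F ->
  rep (incl_VTL u)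
    (fun a c => F (restrict a) (restrict c) * (a ord_max == c ord_max))%N.
Proof.
move=> [k [X [-> FX]]]; exists k, (add_strand X).
split; first by rewrite incl_VTLZ incl_basis.
by move=> a c; rewrite FX compat_add_strand -mulnb mulnA.
Qed.

Definition extend n (b : coloring n) (t : bool) : coloring n.+1 :=
  [ffun j => if unlift ord_max j is Some i then b i else t].

Lemma restrict_extend n (b : coloring n) t : restrict (extend b t) = b.
Proof. by apply/ffunP => j; rewrite !ffunE liftK. Qed.

Lemma extend_max n (b : coloring n) t : extend b t ord_max = t.
Proof. by rewrite ffunE unlift_none. Qed.

Lemma extend_restrict n (b : coloring n.+1) : extend (restrict b) (b ord_max) = b.
Proof.
apply/ffunP => j; rewrite ffunE; case: unliftP => [i|] -> //.
by rewrite ffunE.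
Qed.

(** A colouring of n+1 strands is a colouring of n strands with a colour [t] for the last. The added
    strand forces [t] to be the last colour of [c], so only the sum over n strands remains. *)
Lemma incl_VTLM n : {morph @incl_VTL K d n : u v / u * v}.
Proof.
elim/VTL_linear_ind => [u u' IHu IHu' v|k u IHu v|X].
- by rewrite mulrDl !incl_VTLD mulrDl IHu IHu'.
- by rewrite -scalerAl !incl_VTLZ -scalerAl IHu.
elim/VTL_linear_ind => [v v' IHv IHv'|k v IHv|Y].
- by rewrite mulrDr !incl_VTLD mulrDr IHv IHv'.
- by rewrite -scalerAr !incl_VTLZ -scalerAr IHv.
have rb := rep_basis d; apply: rep_inj (rep_incl (rep_mulr (rb _ _) (rb _ _)))
  (rep_mulr (rep_incl (rb _ _)) (rep_incl (rb _ _))) _ => a c.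
rewrite /color_mul (reindex (fun bt => extend bt.1 bt.2)) /=; last first.
  exists (fun b => (restrict b, b ord_max)) => [[b t] _|b _] /=.
    by rewrite restrict_extend extend_max.
  exact: extend_restrict.
rewrite -(pair_bigA _ (fun b t => (compat X (restrict a) (restrict (extend b t)) *
  (a ord_max == extend b t ord_max)) *
  (compat Y (restrict (extend b t)) (restrict c) *
  (extend b t ord_max == c ord_max)))%N) /= big_distrl; apply: eq_bigr => b _ /=.
rewrite (bigD1 (c ord_max)) //= big1 ?addn0 => [|t tc]; rewrite extend_max.
  by rewrite restrict_extend eqxx muln1 mulnAC.
by rewrite (negPf tc) !muln0.
Qed.

Lemma incl_VTL1 n : incl_VTL 1 = 1 :> VTL d n.+1.
Proof.
rewrite [LHS]incl_basis; congr basis_elt; apply: val_inj; apply/ffunP => -[] j.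
  by rewrite !ffunE; case: unliftP => [i|] ->; rewrite ?ffunE.
by rewrite !ffunE; case: unliftP => [i|] ->; rewrite ?ffunE.
Qed.

HB.instance Definition _ n := GRing.isMonoidMorphism.Build (VTL d n) (VTL d n.+1)
  (@incl_VTL K d n) (conj (@incl_VTL1 n) (@incl_VTLM n)).

Lemma lift_pos n (i : 'I_n) : lift ord_max (pos i) = pos (pos i).
Proof. by apply: ord_inj; rewrite lift_max. Qed.

Lemma lift_pos_succ n (i : 'I_n) : lift ord_max (pos_succ i) = pos_succ (pos i).
Proof. by apply: ord_inj; rewrite lift_max. Qed.

Lemma incl_e n (i : 'I_n) : incl_VTL (gen_e d i) = gen_e d (pos i).
Proof.
apply: rep_inj (rep_incl (rep_e i)) (rep_e (pos i)) _ => a c.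
rewrite mulnb; congr nat_of_bool; apply/andP/capP; rewrite -lift_pos -lift_pos_succ.
  case=> /capP[]; rewrite !ffunE => apq cpq H /eqP max; split=> // j.
  case: (unliftP ord_max j) => [k|] -> //; rewrite !(inj_eq lift_inj) => kp kq.
  by have := H k kp kq; rewrite !ffunE.
case=> apq cpq H; split; last by rewrite H // neq_lift.
apply/capP; rewrite !ffunE; split=> // j jp jq.
by rewrite !ffunE H ?(inj_eq lift_inj).
Qed.

Lemma incl_v n (i : 'I_n) : incl_VTL (gen_v d i) = gen_v d (pos i).
Proof.
apply: rep_inj (rep_incl (rep_v i)) (rep_v (pos i)) _ => a c.
rewrite mulnb !compat_perm; congr nat_of_bool.
have permE k : gen_perm (pos i) (lift ord_max k) = lift ord_max (gen_perm i k).
  by rewrite /gen_perm -lift_pos -lift_pos_succ inj_tperm //; apply: lift_inj.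
have perm_max : gen_perm (pos i) ord_max = ord_max.
  by rewrite /gen_perm -lift_pos -lift_pos_succ tpermD // eq_sym neq_lift.
apply/andP/eqP => [[/eqP /ffunP rac /eqP max]|->].
  apply/ffunP => j; case: (unliftP ord_max j) => [k|] ->.
    by have := rac k; rewrite !ffunE permE.
  by rewrite ffunE perm_max.
split; last by rewrite ffunE perm_max.
by apply/eqP/ffunP => k; rewrite !ffunE permE.
Qed.

End Inclusion.

(** * The last generators commute with the twice included algebra *)

Section Commutation.
Variable n : nat.

Let p : 'I_n.+2 := pos ord_max.
Let q : 'I_n.+2 := pos_succ ord_max.

Let p_lift : p = lift ord_max ord_max.
Proof. by apply: ord_inj; rewrite lift_max. Qed.
Let q_max : q = ord_max. Proof. exact: val_inj. Qed.

Let restrict2_p (j : 'I_n) : lift ord_max (lift ord_max j) != p.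
Proof. by rewrite p_lift (inj_eq lift_inj) eq_sym neq_lift. Qed.

Let restrict2_q (j : 'I_n) : lift ord_max (lift ord_max j) != q.
Proof. by rewrite q_max eq_sym neq_lift. Qed.

Let restrict2_recolor t (a : coloring n.+2) :
  restrict (restrict (recolor p q t a)) = restrict (restrict a).
Proof.
by apply/ffunP => j; rewrite !ffunE (negPf (restrict2_p j)) (negPf (restrict2_q j)).
Qed.

Let restrict2_permute (a : coloring n.+2) :
  restrict (restrict (permute (gen_perm ord_max) a)) = restrict (restrict a).
Proof. by apply/ffunP => j; rewrite !ffunE tperm_neq ?restrict2_p ?restrict2_q. Qed.

Let rep_incl2 (u : VTL d n) F : rep u F -> rep (incl_VTL (incl_VTL u))
  (fun a c => F (restrict (restrict a)) (restrict (restrict c)) *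
     (a p == c p) * (a q == c q))%N.
Proof.
move=> uF; apply: rep_ext (rep_incl (rep_incl uF)) _ => a c.
by rewrite !ffunE p_lift q_max.
Qed.

(** The matrix of the included diagram sees the first n strands and is diagonal on the last two,
    while e changes the last two only. *)
Lemma gen_e_commute (u : VTL d n) :
  GRing.comm (gen_e d ord_max) (incl_VTL (incl_VTL u)).
Proof.
rewrite /GRing.comm; elim/VTL_linear_ind: u => [u v IHu IHv|k u IHu|X].
- by rewrite !incl_VTLD mulrDr mulrDl IHu IHv.
- by rewrite !incl_VTLZ -scalerAl -scalerAr IHu.
have re := rep_e (@ord_max n); have rX := rep_incl2 (rep_basis d X).
apply: rep_inj (rep_mulr re rX) (rep_mulr rX re) _ => a c.
rewrite color_mul_capl color_mul_capr !big_bool /=.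
rewrite !restrict2_recolor !ffunE !eqxx !orbT /=.
rewrite -!mulnA -!mulnDr !mulnA ![(_ * compat _ _ _)%N]mulnC -!mulnA; congr muln.
by case: (a p); case: (a q); case: (c p); case: (c q).
Qed.

Lemma gen_v_commute (u : VTL d n) :
  GRing.comm (gen_v d ord_max) (incl_VTL (incl_VTL u)).
Proof.
rewrite /GRing.comm; elim/VTL_linear_ind: u => [u v IHu IHv|k u IHu|X].
- by rewrite !incl_VTLD mulrDr mulrDl IHu IHv.
- by rewrite !incl_VTLZ -scalerAl -scalerAr IHu.
have rv := rep_v (@ord_max n); have rX := rep_incl2 (rep_basis d X).
apply: rep_inj (rep_mulr rv rX) (rep_mulr rX rv) _ => a c.
rewrite color_mul_perml color_mul_permr tpermV !restrict2_permute !ffunE.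
rewrite tpermL tpermR.
by rewrite mulnAC.
Qed.

End Commutation.

End Generators.

(** * Left ideals and the recursion *)

Section LeftAction.
Variables (K : fieldType) (d : K) (n : nat) (f : VTL d n.+1).
Hypothesis d_neq0 : d != 0.
Hypothesis ef0 : forall i : 'I_n, gen_e d i * f = 0.
Hypothesis vf : forall i : 'I_n, gen_v d i * f = f.

Let fixes (s : 'S_n.+1) := basis_elt d (perm_diag s) * f = f.

Let fixesM s t : fixes s -> fixes t -> fixes (s * t)%g.
Proof. by rewrite /fixes -mul_basis_perm -mulrA => fs ->. Qed.

(** Induction on the distance of the two positions: conjugating by an adjacent transposition
    shortens it by one. *)
Let fixes_tperm (p q : 'I_n.+1) : fixes (tperm p q).
Proof.
suff lt_case k (r r' : 'I_n.+1) : r' = (r + k.+1)%N :> nat -> fixes (tperm r r').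
  have [pq|qp|/ord_inj ->] := ltngtP p q.
  - by apply: (lt_case (q - p.+1)%N); rewrite addnS -addSn subnKC.
  - by rewrite tpermC; apply: (lt_case (p - q.+1)%N); rewrite addnS -addSn subnKC.
  by rewrite tperm1 /fixes basis_perm1 mul1r.
elim: k r r' => [|k IHk] r r' defr'.
  have rn : (r < n)%N by have := ltn_ord r'; rewrite defr' addn1 ltnS.
  have -> : tperm r r' = gen_perm (Ordinal rn).
    by congr tperm; apply: ord_inj; rewrite //= defr' addn1.
  by rewrite /fixes -gen_vE vf.
have r2n : (r + k.+1 < n.+1)%N.
  by apply: leq_trans (ltn_ord r'); rewrite defr' !addnS.
pose r2 := Ordinal r2n.
have rr2 : r != r2 by rewrite -val_eqE /= neq_ltn -addSnnS leq_addr.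
have rr' : r != r' by rewrite -val_eqE /= defr' neq_ltn -addSnnS leq_addr.
have r2r' : r' = (r2 + 1)%N :> nat by rewrite defr' /= addn1 addnS.
have fix1 : fixes (tperm r2 r').
  have r2lt : (r2 < n)%N by have := ltn_ord r'; rewrite r2r' addn1 ltnS.
  have -> : tperm r2 r' = gen_perm (Ordinal r2lt).
    by congr tperm; apply: ord_inj; rewrite //= r2r' addn1.
  by rewrite /fixes -gen_vE vf.
have <- : (tperm r r2 ^ tperm r2 r')%g = tperm r r'.
  by rewrite tpermJ tpermL tperm_neq.
by rewrite conjgE tpermV; apply: fixesM => //; apply: fixesM => //; apply: IHk.
Qed.

Let fixes_all s : fixes s.
Proof.
have [ts -> _] := prod_tpermP s; apply: big_ind => //.
by rewrite /fixes basis_perm1 mul1r.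
Qed.

Let compat_recolor (X : diagram n.+1) p q t a (c : coloring n.+1) :
  X (inr p) = inr q -> c p = c q -> compat X a c -> compat X a (recolor p q t c).
Proof.
move=> Xpq cpq /compatP Xac; have Xqp : X (inr q) = inr p by rewrite -Xpq partnerK.
have glueE r : r != inr p -> r != inr q -> glue a (recolor p q t c) r = glue a c r.
  by case: r => j //= jp jq; rewrite ffunE ifF //; apply/norP.
apply/compatP => r; have [->|rp] := eqVneq r (inr p).
  by rewrite Xpq /= !ffunE !eqxx orbT.
have [->|rq] := eqVneq r (inr q); first by rewrite Xqp /= !ffunE !eqxx orbT.
by rewrite !glueE ?Xac // (can2_eq (partnerK X) (partnerK X)) ?Xpq ?Xqp.
Qed.

(** With [u] the conjugate of e_i whose arcs join [p] and [q], stacking [X] on [u] closes one loop,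
    so X u = d X. Since u f = 0 and d is non-zero, X f = 0. *)
Let cap_kills (X : diagram n.+1) (p q : 'I_n.+1) :
  X (inr p) = inr q -> basis_elt d X * f = 0.
Proof.
(* Only a position below [n] is the left end of some e_i; of the two distinct positions at least one
   is such. *)
wlog pn : p q / (p < n)%N.
  move=> IH Xpq; have Xqp : X (inr q) = inr p by rewrite -Xpq partnerK.
  have [pn|] := boolP (p < n)%N; first exact: IH Xpq.
  rewrite -leqNgt => np; apply: IH Xqp; rewrite ltn_neqAle -ltnS ltn_ord andbT.
  apply: contra (partner_neq X (inr p)) => /eqP qn; rewrite Xpq.
  apply/eqP; congr inr; apply: ord_inj; apply/eqP.
  by rewrite qn eqn_leq np -ltnS ltn_ord.
move=> Xpq; have pq : p != q.
  by apply: contra (partner_neq X (inr p)) => /eqP pq; rewrite Xpq pq.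
pose i := Ordinal pn; have pos_i : pos i = p by exact: ord_inj.
pose s := tperm (pos_succ i) q.
have sp : s (pos i) = p by rewrite /s tperm_neq ?pos_neq // pos_i.
have sq : s (pos_succ i) = q by rewrite /s tpermL.
pose u := basis_elt d (perm_diag s) * (gen_e d i * basis_elt d (perm_diag s)).
have uf : u * f = 0 by rewrite /u -!mulrA fixes_all ef0 mulr0.
suff Xu : basis_elt d X * u = d *: basis_elt d X.
  apply: (scalerI d_neq0); rewrite scaler0 scalerAl -Xu -mulrA uf.
  exact: mulr0.
have rb := rep_basis d; apply: rep_inj (rep_scale (rb _ X)) _.
  exact: rep_mulr (rb _ _) (rep_mulr (rb _ _) (rep_mulr (rep_e d i) (rb _ _))).
move=> a c; rewrite (@eq_color_mul _ _ (compat X) _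
  (fun a c => cap p q a c : nat)) //; last first.
  by move=> a' c'; rewrite color_mul_perml color_mul_permr tpermV cap_permute sp sq.
rewrite color_mul_capr; have [/eqP cpq|cpq] := boolP (c p == c q); last first.
  rewrite mul0n; have /negPf -> // : ~~ compat X a c.
  by apply: contra cpq => /compatP/(_ (inr p)); rewrite Xpq /= => ->.
have updE t : compat X a (recolor p q t c) = compat X a c.
  apply/idP/idP; last exact: compat_recolor.
  have -> : compat X a c = compat X a (recolor p q (c p) (recolor p q t c)).
    congr compat; apply/ffunP => j; rewrite !ffunE.
    by have [->|_] := eqVneq j p => //=; have [->|] := eqVneq j q.
  by apply: compat_recolor => //; rewrite !ffunE !eqxx orbT.
by rewrite mul1n big_bool /= !updE mul2n addnn.
Qed.

(** Either some arc of [X] joins two bottom points and [X] kills [f], or [X] is a permutation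
    diagram and fixes [f]. *)
Let basis_scalar (X : diagram n.+1) : exists k : K, basis_elt d X * f = k *: f.
Proof.
have [/existsP[p /existsP[q /eqP Xpq]]|] :=
    boolP [exists p, [exists q, X (inr p) == inr q]].
  by exists 0; rewrite (cap_kills Xpq) scale0r.
rewrite negb_exists => /forallP noX; exists 1; rewrite scale1r.
(* Under [noX] every bottom point goes to a top point, so the default [j] is not reached. *)
pose h j := if X (inr j) is inl i then i else j.
have hE j : X (inr j) = inl (h j).
  rewrite /h; have := noX j; rewrite negb_exists => /forallP.
  by case: (X (inr j)) => // i /(_ i); rewrite eqxx.
have h_inj : injective h.
  move=> j j' hj; suff /(inv_inj (partnerK X)) [->] : X (inr j) = X (inr j') by [].
  by rewrite !hE hj.
(* The inverse appears because [h] sends bottom points to top points. *)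
suff -> : X = perm_diag (perm h_inj)^-1%g by apply: fixes_all.
apply: val_inj; apply/ffunP => -[] j; rewrite ffunE /= ?invgK.
  by rewrite -{1}[j](permKV (perm h_inj)) permE -hE partnerK.
by rewrite permE hE.
Qed.

Lemma left_scalar u : exists k : K, u * f = k *: f.
Proof.
elim/VTL_linear_ind: u => [u v [k Eu] [l Ev]|k u [l Eu]|X].
- by exists (k + l); rewrite mulrDl Eu Ev scalerDl.
- by exists (k * l); rewrite -scalerAl Eu scalerA.
exact: basis_scalar.
Qed.

End LeftAction.

(** * One step of the recursion in an abstract algebra *)

Section Recursion.
Variables (K : fieldType) (A : algType K).
Variables (d x y z x' y' z' : K) (e v e' v' g g' : A).
Hypotheses (ee : e * e = d *: e) (ve : v * e = e) (ev : e * v = e).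
Hypotheses (vv : v * v = 1) (eve : e * v' * e = e) (vve : v * v' * e = e' * e).
Hypotheses (evv : e * v' * v = e * e') (vev : v * e' * v = v' * e * v').
Hypotheses (vvv : v * v' * v = v' * v * v').
Hypotheses (eg' : GRing.comm e g') (vg' : GRing.comm v g').
Hypotheses (g'g : g' * g = g) (e'g : e' * g = 0) (v'g : v' * g = g).
Hypothesis gE : g = x' *: g' + y' *: (g' * e' * g') + z' *: (g' * v' * g').
Hypotheses (zx' : z * x' = x) (yz' : y * z' = y * y' + z * y').
Hypothesis xyz : x + y * (x' * d + y' + z') + z * (x' + y') = 0.

(** Here [g] and [g'] stand for the included P_(n-1) and P_(n-2), the letters [e], [v] for the last
    generators, and [e'], [v'] for those before them. *)
Let P := x *: g + y *: (g * e * g) + z *: (g * v * g).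

Let gM w : g * w = x' *: (g' * w) + y' *: (g' * (e' * (g' * w)))
  + z' *: (g' * (v' * (g' * w))).
Proof. by rewrite gE !mulrDl -!scalerAl -!mulrA. Qed.

Let eC w : e * (g' * w) = g' * (e * w). Proof. by rewrite mulrA eg' mulrA. Qed.
Let vC w : v * (g' * w) = g' * (v * w). Proof. by rewrite mulrA vg' mulrA. Qed.

Let v'e'e : v * e' * e = v' * e.
Proof. by rewrite -mulrA -vve !mulrA vv mul1r. Qed.

Let ee'e : e * e' * e = e.
Proof. by rewrite -evv -mulrA ve eve. Qed.

Let e'ev' : e' * e * v' = e' * v.
Proof. by rewrite -vve -!mulrA [v' * (e * v')]mulrA -vev -!mulrA mulrA vv mul1r. Qed.

Let geg : g * (e * g) =
  x' *: (e * g) + y' *: (g' * (e' * (e * g))) + z' *: (g' * (v' * (e * g))).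
Proof. by rewrite gM -!eC g'g. Qed.

(** In the middle term, e' v g = e' e v' g = e' e g. *)
Let gvg : g * (v * g) =
  x' *: (v * g) + y' *: (g' * (e' * (e * g))) + z' *: (g' * (v' * (v * g))).
Proof. by rewrite gM -!vC g'g [e' * (v * g)]mulrA -e'ev' -!mulrA v'g. Qed.

(** After expansion each term of e P is a multiple of e g, except one containing e e' g = 0; the
    total coefficient is the left side of [xyz]. *)
Lemma recursion_e : e * P = 0.
Proof.
have eee w : e * (e' * (e * w)) = e * w by rewrite !mulrA ee'e.
have evew w : e * (v' * (e * w)) = e * w by rewrite !mulrA eve.
have evvw w : e * (v' * (v * w)) = e * (e' * w) by rewrite !mulrA evv.
rewrite /P -!mulrA !mulrDr -!scalerAr geg gvg !mulrDr -!scalerAr !eC.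
rewrite eee evew evvw e'g !mulr0 -eC g'g [e * (e * g)]mulrA ee -scalerAl.
rewrite [e * (v * g)]mulrA ev scaler0 addr0 scalerA -!scalerDl !scalerA.
by rewrite -!scalerDl xyz scale0r.
Qed.

(** Left multiplication by [v] swaps g with v g and g' e' e g with g' v' e g, and fixes e g and g'
    v' v g; [zx'] and [yz'] say that swapped terms have equal coefficients. *)
Lemma recursion_v : v * P = P.
Proof.
rewrite /P -!mulrA !mulrDr -!scalerAr geg gvg !mulrDr -!scalerAr.
rewrite [v * (e * g)]mulrA ve [v * (v * g)]mulrA vv mul1r !vC.
have -> : v * (e' * (e * g)) = v' * (e * g) by rewrite !mulrA v'e'e.
have -> : v * (v' * (e * g)) = e' * (e * g) by rewrite !mulrA vve.
have -> : v * (v' * (v * g)) = v' * (v * g) by rewrite !mulrA vvv -mulrA v'g.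
rewrite !scalerDr !scalerA zx' yz' !scalerDl.
(* Both sides now have the same eight summands, which the pattern reorders. *)
by rewrite [LHS](AC ((1*((1*1)*(1*1)))*((1*1)*1)) ((6*((2*4)*(3*7)))*((1*5)*8))).
Qed.

End Recursion.

(** * The projectors *)

Section Projectors.
Variables (K : fieldType) (d : K).
Hypothesis natS_neq0 : forall k : nat, k.+1%:R != 0 :> K.
Hypothesis dD_neq0 : forall k : nat, d + k%:R != 0.

(** The index is shifted: [rproj m] is P_(m+1), and [m] counts the generators e_i of its algebra. *)
Fixpoint rproj (m : nat) : VTL d m.+1 :=
  match m with
  | 0 => 1
  | m'.+1 =>
      x_coef K m *: incl_VTL (rproj m')
      + y_coef d m *: (incl_VTL (rproj m') * gen_e d ord_max * incl_VTL (rproj m'))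
      + z_coef K m *: (incl_VTL (rproj m') * gen_v d ord_max * incl_VTL (rproj m'))
  end.

Let den_nat m : 1 + m%:R + 1 != 0 :> K.
Proof. by have -> : 1 + m%:R + 1 = m.+2%:R :> K by ring. Qed.

Let den_d m : d + 2 * (1 + m%:R) - 2 != 0.
Proof. by have -> : d + 2 * (1 + m%:R) - 2 = d + (2 * m)%:R by ring. Qed.

Let den_natS m : 2 + m%:R + 1 != 0 :> K.
Proof. by have -> : 2 + m%:R + 1 = 1 + m.+1%:R + 1 :> K by ring. Qed.

Let den_dS m : d + 2 * (2 + m%:R) - 2 != 0.
Proof. by have -> : 2 + m%:R = 1 + m.+1%:R :> K by ring. Qed.

Lemma x_coefD_z m : x_coef K m.+1 + z_coef K m.+1 = 1.
Proof. by rewrite /x_coef /z_coef; field; rewrite den_nat. Qed.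

Lemma z_coefM_x m : z_coef K m.+2 * x_coef K m.+1 = x_coef K m.+2.
Proof. by rewrite /x_coef /z_coef; field; rewrite den_nat den_natS. Qed.

Lemma y_coefM_z m : y_coef d m.+2 * z_coef K m.+1 =
  y_coef d m.+2 * y_coef d m.+1 + z_coef K m.+2 * y_coef d m.+1.
Proof.
by rewrite /y_coef /z_coef; field; rewrite den_nat den_natS den_d den_dS.
Qed.

(** This is the condition [xyz] of the abstract recursion, the vanishing of the coefficient of e
    g. *)
Lemma coef_trace m :
  x_coef K m.+2
  + y_coef d m.+2 * (x_coef K m.+1 * d + y_coef d m.+1 + z_coef K m.+1)
  + z_coef K m.+2 * (x_coef K m.+1 + y_coef d m.+1) = 0.
Proof.
by rewrite /x_coef /y_coef /z_coef; field; rewrite den_nat den_natS den_d den_dS.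
Qed.

(** This gives e_1 P_2 = 0, where no earlier projector is available for expansion. *)
Lemma coef_base : x_coef K 1 + y_coef d 1 * d + z_coef K 1 = 0.
Proof.
rewrite /x_coef /y_coef /z_coef; field.
have := natS_neq0 1; have := dD_neq0 0; rewrite addr0 => d0 two.
by rewrite two addrK d0.
Qed.

Lemma pos_lift n (i : 'I_n) : lift ord_max i = pos i.
Proof. by apply: ord_inj; rewrite lift_max. Qed.

Lemma rproj_absorb m : rproj m * rproj m = rproj m ->
  incl_VTL (rproj m) * rproj m.+1 = rproj m.+1 /\
  rproj m.+1 * incl_VTL (rproj m) = rproj m.+1.
Proof.
move=> idem; have gg : incl_VTL (rproj m) * incl_VTL (rproj m) = incl_VTL (rproj m).
  by rewrite -rmorphM /= idem.
rewrite /= !(mulrDl, mulrDr) -!(scalerAl, scalerAr) !mulrA gg.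
by rewrite -!mulrA gg.
Qed.

Let left_killed m := [/\ rproj m * rproj m = rproj m,
  forall i : 'I_m, gen_e d i * rproj m = 0 &
  forall i : 'I_m, gen_v d i * rproj m = rproj m].

Let last_killed m := gen_e d ord_max * rproj m.+1 = 0 /\
  gen_v d ord_max * rproj m.+1 = rproj m.+1.

Let last_killed0 : last_killed 0.
Proof.
rewrite /last_killed /= rmorph1 !mulr1 !mul1r !mulrDr -!scalerAr !mulr1.
rewrite gen_ee gen_ev gen_ve gen_vv scalerA -!scalerDl coef_base scale0r.
by split=> //; rewrite addrAC [RHS]addrAC; congr (_ + _); apply: addrC.
Qed.

Let last_killedS m :
  rproj m * rproj m = rproj m -> left_killed m.+1 -> last_killed m.+1.
Proof.
move=> idem [_ eP vP]; have [gP _] := rproj_absorb idem.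
have adj : pos_succ (pos (@ord_max m)) = pos ord_max by exact: ord_inj.
have g'g : incl_VTL (incl_VTL (rproj m)) * incl_VTL (rproj m.+1) =
    incl_VTL (rproj m.+1).
  by rewrite -rmorphM gP.
have e'g : gen_e d (pos ord_max) * incl_VTL (rproj m.+1) = 0.
  by rewrite -incl_e -rmorphM eP rmorph0.
have v'g : gen_v d (pos ord_max) * incl_VTL (rproj m.+1) = incl_VTL (rproj m.+1).
  by rewrite -incl_v -rmorphM vP.
have gE : incl_VTL (rproj m.+1) = x_coef K m.+1 *: incl_VTL (incl_VTL (rproj m))
    + y_coef d m.+1 *: (incl_VTL (incl_VTL (rproj m)) * gen_e d (pos ord_max)
                        * incl_VTL (incl_VTL (rproj m)))
    + z_coef K m.+1 *: (incl_VTL (incl_VTL (rproj m)) * gen_v d (pos ord_max)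
                        * incl_VTL (incl_VTL (rproj m))).
  by rewrite [rproj m.+1]/= !incl_VTLD !incl_VTLZ !incl_VTLM incl_e incl_v.
split.
  exact: (recursion_e (gen_ee _ _) (gen_ve _ _) (gen_ev _ _) (gen_vv _ _)
    (gen_eve _ adj) (gen_vve _ adj) (gen_evv _ adj) (gen_vev _ adj)
    (gen_e_commute _) (gen_v_commute _) g'g e'g v'g gE (coef_trace m)).
exact: (recursion_v (gen_ve _ _) (gen_vv _ _) (gen_vve _ adj) (gen_vev _ adj)
  (gen_vvv _ adj) (gen_e_commute _) (gen_v_commute _) g'g v'g gE
  (z_coefM_x m) (y_coefM_z m)).
Qed.

Let left_killedS m : last_killed m -> left_killed m -> left_killed m.+1.
Proof.
move=> [eP vP] [idem eg vg]; have [gP Pg] := rproj_absorb idem; split.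
(* Expanding the left factor and using g P = P, e P = 0 and v P = P leaves P P = (x + z) P, and x +
   z = 1. *)
- rewrite {1}/rproj -/rproj !mulrDl -!scalerAl -!mulrA gP eP vP mulr0 scaler0 addr0.
  by rewrite gP -scalerDl x_coefD_z scale1r.
- move=> i; case: (unliftP ord_max i) => [j|] -> //.
  by rewrite pos_lift -gP mulrA -incl_e -rmorphM /= eg rmorph0 mul0r.
move=> i; case: (unliftP ord_max i) => [j|] -> //.
by rewrite pos_lift -gP mulrA -incl_v -rmorphM /= vg.
Qed.

Lemma rproj_left_killed m : left_killed m.
Proof.
(* Two consecutive levels are carried, since the step to P_n expands P_(n-1) through P_(n-2). *)
suff [//] : left_killed m /\ left_killed m.+1.
elim: m => [|m [IH IHS]].
  have base : left_killed 0 by split=> [|[]|[]] //; rewrite mul1r.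
  by split=> //; apply: left_killedS.
split=> //; apply: left_killedS => //; apply: last_killedS => //.
by case: IH.
Qed.

(** Only x + z = 1 survives when [f] meets the recursion from the left. The morphism [h] lets the
    induction pass to smaller algebras while [f] stays in the large one. *)
Lemma rproj_right_fixed m n (h : {lrmorphism VTL d m.+1 -> VTL d n}) f :
  (forall i : 'I_m, f * h (gen_e d i) = 0) ->
  (forall i : 'I_m, f * h (gen_v d i) = f) -> f * h (rproj m) = f.
Proof.
elim: m h => [|m IHm] h fe fv; first by rewrite rmorph1 mulr1.
have fg : f * h (incl_VTL (rproj m)) = f.
  pose hi : {lrmorphism VTL d m.+1 -> VTL d n} := h \o @incl_VTL K d m.+1.
  have := IHm hi; rewrite /hi /=; apply=> i; first by rewrite incl_e fe.
  by rewrite incl_v fv.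
rewrite /= !linearD !linearZ /= !rmorphM /= !mulrDr -!scalerAr !mulrA fg fe fv.
by rewrite mul0r fg scaler0 addr0 -scalerDl x_coefD_z scale1r.
Qed.

Lemma projector_unique m (f : VTL d m.+1) : is_projector f -> f = rproj m.
Proof.
move=> [f0 ff fe fv]; have [_ eP vP] := rproj_left_killed m.
have d0 : d != 0 by have := dD_neq0 0; rewrite addr0.
have fP : f * rproj m = f.
  apply: (@rproj_right_fixed m _ idfun) => i /=; first by have [] := fe i.
  by have [] := fv i.
have [k Ek] := left_scalar d0 eP vP f.
have fE : f = k *: rproj m by rewrite -Ek.
(* Indeed k f = k (f P) = f (k P) = f f = f. *)
have /eqP : (k - 1) *: f = 0.
  by rewrite scalerBl scale1r -{1}fP scalerAr -fE [f * f]ff subrr.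
rewrite scaler_eq0 (negPf f0) orbF subr_eq0 => /eqP k1.
by rewrite fE k1 scale1r.
Qed.

Lemma rprojE m : rproj m.+1 = incl_VTL (rproj m) * fK d m.
Proof.
elim: m => [|m IHm].
  by rewrite /= rmorph1 !mul1r !mulr1.
have [idem _ _] := rproj_left_killed m; have [_ Pg] := rproj_absorb idem.
have gg' : incl_VTL (rproj m.+1) * incl_VTL (incl_VTL (rproj m)) =
    incl_VTL (rproj m.+1).
  by rewrite -rmorphM Pg.
(* Write g = g g' and move g' past [u]; by the induction hypothesis g' times the included [fK d m]
   is g again. *)
have absorb u : GRing.comm u (incl_VTL (incl_VTL (rproj m))) ->
    incl_VTL (rproj m.+1) * (u * incl_VTL (fK d m)) =
    incl_VTL (rproj m.+1) * u * incl_VTL (rproj m.+1).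
  move=> cu; rewrite -{1}gg' -mulrA [_ * (u * _)]mulrA -cu -[u * _ * _]mulrA.
  by rewrite -rmorphM -IHm mulrA.
have -> : fK d m.+1 = x_coef K m.+2 *: 1
    + y_coef d m.+2 *: (gen_e d ord_max * incl_VTL (fK d m))
    + z_coef K m.+2 *: (gen_v d ord_max * incl_VTL (fK d m)) by [].
rewrite !mulrDr -!scalerAr mulr1 !absorb //; first exact: gen_v_commute.
exact: gen_e_commute.
Qed.

Lemma projector_factor m (f : VTL d m.+2) (g : VTL d m.+1) :
  is_projector f -> is_projector g -> f = incl_VTL g *v fK d m.
Proof. by move=> /projector_unique -> /projector_unique ->; apply: rprojE. Qed.

End Projectors.

Theorem lemma3p1 (R : realType) (m : nat)
    (f : VTL (indet R) m.+2) (g : VTL (indet R) m.+1)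
    (hf : is_projector f) (hg : is_projector g) :
  f = incl_VTL g *v fK (indet R) m.
Proof.
have natS k : k.+1%:R != 0 :> ratfun R.
  by rewrite -(rmorph_nat (@tofrac _)) tofrac_eq0 -polyC_natr polyC_eq0
    Num.Theory.pnatr_eq0.
(* The element d + k is the image of a polynomial of degree one, hence non-zero. *)
have indetD k : indet R + k%:R != 0.
  rewrite /indet -(rmorph_nat (@tofrac _)) -rmorphD tofrac_eq0 -polyC_natr.
  by rewrite -size_poly_eq0 size_XaddC.
exact: projector_factor natS indetD _ _ _ hf hg.
Qed.
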